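(* Let $k$ be a finite field of cardinality $q$, let $\ell$ be a finite extension of $k$ of degree $r$, and let $s$ be a positive integer. Let $\mathcal{C}\subseteq \mathrm{End}_k(\ell)^s$ be an $\ell$-linear code in the sum-rank metric of $\ell$-dimension $2$ and of minimum distance $rs-1$. Then, if $r=1$ we have $s\leq q+1$; otherwise (if $r>1$) we have $s\leq q-1$.
   Context: $\mathrm{End}_k(\ell)$ is the space of $k$-linear endomorphisms of $\ell$; it is an $\ell$-vector space via $(a\varphi)(y)=a\cdot\varphi(y)$ for $a,y\in\ell$, and $\mathrm{End}_k(\ell)^s$ is an $\ell$-vector space componentwise. The sum-rank weight of $\underline\varphi=(\varphi_1,\dots,\varphi_s)\in\mathrm{End}_k(\ell)^s$ is $w_{\mathrm{srk}}(\underline\varphi)=\sum_{i=1}^s\mathrm{rk}(\varphi_i)=\sum_{i=1}^s\dim_k\varphi_i(\ell)$. An $\ell$-linear code is an $\ell$-linear subspace $\mathcal{C}\subseteq\mathrm{End}_k(\ell)^s$; its $\ell$-dimension is $\dim_\ell\mathcal{C}$ and its minimum distance is $\min\{w_{\mathrm{srk}}(\underline\varphi)\mid\underline\varphi\in\mathcal{C},\ \underline\varphi\neq 0\}$. *)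

(* Defs.v *)
From HB Require Import structures.
From mathcomp Require Import all_boot all_algebra all_field.

Set Implicit Arguments.
Unset Strict Implicit.
Unset Printing Implicit Defensive.

Import GRing.Theory.
Local Open Scope ring_scope.

(* End_k(l) as a vector space over l, with (a *: f) y = a * f y. This is an   *)
(* alias because 'End(l) itself already carries its k-vector space structure. *)
Definition lEnd (k : fieldType) (l : fieldExtType k) : Type := 'End(l).

Section LEndVect.
Variables (k : fieldType) (l : fieldExtType k).

HB.instance Definition _ := GRing.Zmodule.copy (lEnd l) 'End(l).

Definition lEnd_scale (a : l) (f : lEnd l) : lEnd l :=
  (amull a \o (f : 'End(l)))%VF.

Lemma lEnd_scaleE a (f : lEnd l) (y : l) :
  (lEnd_scale a f : 'End(l)) y = a * (f : 'End(l)) y.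
Proof. by rewrite comp_lfunE lfunE. Qed.

Lemma lEnd_addE (f g : lEnd l) (y : l) :
  (f + g : 'End(l)) y = (f : 'End(l)) y + (g : 'End(l)) y.
Proof. exact: add_lfunE. Qed.

Fact lEnd_scaleA a b f : lEnd_scale a (lEnd_scale b f) = lEnd_scale (a * b) f.
Proof. by apply/lfunP => y; rewrite !lEnd_scaleE mulrA. Qed.

Fact lEnd_scale1 : left_id 1 lEnd_scale.
Proof. by move=> f; apply/lfunP => y; rewrite lEnd_scaleE mul1r. Qed.

Fact lEnd_scaleDr : right_distributive lEnd_scale +%R.
Proof.
move=> a f g; apply/lfunP => y.
by rewrite lEnd_addE !lEnd_scaleE lEnd_addE mulrDr.
Qed.

Fact lEnd_scaleDl f : {morph lEnd_scale^~ f : a b / a + b}.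
Proof.
by move=> a b; apply/lfunP => y; rewrite lEnd_addE !lEnd_scaleE mulrDl.
Qed.

HB.instance Definition _ := GRing.Zmodule_isLmodule.Build l (lEnd l)
  lEnd_scaleA lEnd_scale1 lEnd_scaleDr lEnd_scaleDl.

(* An endomorphism is determined by its values on a k-basis of l, so that     *)
(* End_k(l) has dimension [l : k] over l.                                     *)
Fact lEnd_vect_iso : Vector.axiom (\dim {:l}) (lEnd l).
Proof.
pose b := vbasis {:l}.
pose ev (f : lEnd l) : 'rV[l]_(\dim {:l}) := \row_i (f : 'End(l)) b`_i.
pose un (v : 'rV[l]_(\dim {:l})) (y : l) : l :=
  \sum_i coord b i y *: v ord0 i.
have unL v : linear (un v).
  move=> c x y; rewrite /un scaler_sumr -big_split /=; apply: eq_bigr => i _.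
  by rewrite linearP scalerDl scalerA.
pose unM v := GRing.isLinear.Build k l l *:%R (un v) (unL v).
pose unl v : {linear l -> l} := HB.pack (un v) (unM v).
exists ev.
  by move=> a f g; apply/rowP => i; rewrite !mxE lEnd_addE lEnd_scaleE.
exists (fun v => linfun (unl v) : lEnd l) => [f|v].
  apply/lfunP => y; rewrite lfunE /= /un.
  rewrite [in RHS](coord_vbasis (memvf y)) linear_sum /=.
  by apply: eq_bigr => i _; rewrite linearZ mxE.
apply/rowP => j; rewrite mxE lfunE /= /un (bigD1 j) //=.
have fb : free b by apply: basis_free (vbasisP _).
rewrite coord_free // eqxx scale1r big1 ?addr0 // => i ij.
by rewrite coord_free // eq_sym (negPf ij) scale0r.
Qed.

HB.instance Definition _ :=
  Lmodule_hasFinDim.Build l (lEnd l) lEnd_vect_iso.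

End LEndVect.

Definition sum_rank_weight (k : fieldType) (l : fieldExtType k) (s : nat)
    (f : {ffun 'I_s -> lEnd l}) : nat :=
  (\sum_(i < s) \dim (limg (f i : 'End(l))))%N.

Definition has_min_distance (k : fieldType) (l : fieldExtType k) (s : nat)
    (C : {vspace {ffun 'I_s -> lEnd l}}) (d : nat) : Prop :=
  (exists f, [/\ f \in C, f != 0 & sum_rank_weight f = d]) /\
  (forall f, f \in C -> f != 0 -> (d <= sum_rank_weight f)%N).

(* Main.v *)
Require Import Defs.
From mathcomp Require Import all_boot all_algebra all_field.
From mathcomp Require Import zify.

(** Write Q = q ^ r for the cardinality of l. Since the rank of an endomorphism
    is r minus the dimension of its kernel, minimum distance r s - 1 forces
    the kernels of the components of a nonzero codeword to have total dimension
    at most 1. Hence such a codeword f has at most q - 1 zeros, a zero being a pair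
    (i, x) with x nonzero in l and f_i(x) = 0.

    Conversely, for fixed (i, x) the map f |-> f_i(x) is an l-linear form on the
    plane C, so at least Q - 1 nonzero codewords vanish at (i, x). Counting the
    triples (f, i, x) in both ways ([pencil_count]) gives
      s (Q - 1) (Q - 1) <= (Q ^ 2 - 1) (q - 1),
    that is s (Q - 1) <= (Q + 1) (q - 1). For r = 1 this reads s <= q + 1. For
    r > 1 it reads s <= (q - 1) + 2 (q - 1) / (Q - 1), where the last term is
    less than 1 because (Q - 1) / (q - 1) >= 1 + q >= 3 ([length_bound]). *)

Section Counting.

Import GRing.Theory.
Local Open Scope ring_scope.

(** The equation always has a nonzero solution w, and then all the nonzero
    multiples of w are solutions. *)
Lemma card_nonzero_solutions (F : finFieldType) (u v : F) :
  (#|F| - 1 <=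
   #|[set p : F * F | (p != 0) && (p.1 * u + p.2 * v == 0)]%R|)%N.
Proof.
have [w w0 wE] : exists2 w : F * F, w != 0 & w.1 * u + w.2 * v = 0.
  have [u0|u0] := eqVneq u 0.
    by exists (1, 0); rewrite ?xpair_eqE ?oner_eq0 //= u0 mulr0 mul0r addr0.
  exists (v, - u); first by rewrite xpair_eqE oppr_eq0 (negPf u0) andbF.
  by rewrite /= mulNr [u * v]mulrC subrr.
pose line t := (t * w.1, t * w.2).
have line_inj : injective line.
  move=> t t' [e1 e2]; apply/eqP; apply: contraNT w0 => tt'.
  have zero x : t * x = t' * x -> x == 0.
    move/eqP; rewrite -subr_eq0 -mulrBl mulf_eq0 subr_eq0.
    by rewrite (negPf tt').
  by rewrite [w]surjective_pairing xpair_eqE !zero.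
have -> : (#|F| - 1 = #|[set line t | t in [set~ (0%R : F)]]|)%N.
  by rewrite card_imset // cardsC1 subn1.
apply/subset_leq_card/subsetP => _ /imsetP[t + ->]; rewrite !inE => t0.
have line0 : line 0 = 0 by rewrite /line !mul0r.
by rewrite -line0 (inj_eq line_inj) t0 /= -!mulrA -mulrDr wE mulr0 eqxx.
Qed.

(** The bound on the dimension makes q ^ d - 1 equal to d (q - 1), a linear
    expression that can be summed over the components of a codeword. The alias
    [finvect_type] gives l its structure of finite type. *)
Lemma card_nonzero_ker (k : finFieldType) (l : fieldExtType k)
    (g : 'End(finvect_type l)) :
  (\dim (lker g) <= 1)%N ->
  (#|[set x : finvect_type l | (x != 0) && (g x == 0)]%R| =
    \dim (lker g) * (#|k| - 1))%N.
Proof.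
move=> dg.
have -> : [set x : finvect_type l | (x != 0) && (g x == 0)]
            = [set x in lker g] :\ 0.
  by apply/setP => x; rewrite !inE memv_ker.
have -> : #|[set x in lker g] :\ 0| = (#|lker g| - 1)%N.
  have := cardsD1 0 [set x in lker g].
  by rewrite inE mem0v cardsE add1n => ->; rewrite subn1.
rewrite card_vspace; case: (\dim _) dg => [|[|//]] _.
  by rewrite expn0.
by rewrite expn1 mul1n.
Qed.

Lemma basis_of_dim2 (K : fieldType) (V : vectType K) (C : {vspace V}) :
  \dim C = 2%N ->
  exists b0 b1, [/\ b0 \in C, b1 \in C &
    forall a0 a1, a0 *: b0 + a1 *: b1 = 0 -> a0 = 0 /\ a1 = 0].
Proof.
have := vbasisP C; move: (vbasis C) => b + dC; rewrite dC in b *.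
case/tupleP: b => b0 b; case/tupleP: b => b1 b; rewrite (tuple0 b) /= => bC.
exists b0, b1; split.
- by apply: (basis_mem bC); rewrite !inE eqxx.
- by apply: (basis_mem bC); rewrite !inE eqxx orbT.
move=> a0 a1 a0E; have := basis_free bC.
move/(@freeP _ _ _ [tuple b0; b1])/(_ (fun i => if i == ord0 then a0 else a1)).
rewrite !big_ord_recl big_ord0 /= addr0 => /(_ a0E) a_0.
by split; [exact: (a_0 ord0) | exact: (a_0 ord_max)].
Qed.

Lemma sum_dim_ker (k : fieldType) (l : fieldExtType k) (s : nat)
    (f : {ffun 'I_s -> lEnd l}) :
  (\sum_(i < s) \dim (lker (f i : 'End(l))) + sum_rank_weight f
    = \dim {:l} * s)%N.
Proof.
rewrite -big_split /= mulnC -[in RHS](card_ord s) -sum_nat_const.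
by apply: eq_bigr => i _; rewrite -(limg_ker_dim (f i : 'End(l)) fullv) capfv.
Qed.

(** Coordinates in a basis (b0, b1) of C turn codewords into pairs in l * l, so
    that the double count takes place over finite types. *)
Lemma pencil_count (k : finFieldType) (l : fieldExtType k) (s : nat)
    (C : {vspace {ffun 'I_s -> lEnd l}}) :
  \dim C = 2%N ->
  (forall f, f \in C -> f != 0 -> (\dim {:l} * s - 1 <= sum_rank_weight f)%N) ->
  (s * (#|k| ^ \dim {:l} - 1) <= (#|k| ^ \dim {:l} + 1) * (#|k| - 1))%N.
Proof.
move=> dC wC; set Q := (#|k| ^ \dim {:l})%N.
pose L : finFieldType := finvect_type l.
have QE : #|L| = Q.
  by rewrite /Q -(card_vspace (fullv : {vspace finvect_type l})) card_vspacef.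
have [b0 [b1 [b0C b1C bfree]]] := basis_of_dim2 _ _ _ dC.
pose word (p : L * L) : {ffun 'I_s -> lEnd l} :=
  (p.1 : l) *: b0 + (p.2 : l) *: b1.
pose ev (f : {ffun 'I_s -> lEnd l}) i (x : L) : L := (f i : 'End(l)) x.
have evE p i x : ev (word p) i x = p.1 * ev b0 i x + p.2 * ev b1 i x.
  by rewrite /ev !ffunE lEnd_addE !lEnd_scaleE.
have wordC p : word p \in C by rewrite memvD // memvZ.
have word0 p : p != 0 -> word p != 0.
  case: p => a0 a1; apply: contraNneq => /bfree[/= -> ->].
  by rewrite xpair_eqE eqxx.
have lower : (s * ((Q - 1) * (Q - 1)) <=
    \sum_(i < s) \sum_(x : L | x != 0%R)
      #|[set p : L * L | (p != 0) && (ev (word p) i x == 0)]%R|)%N.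
  rewrite -[s in (s * _)%N]card_ord -sum_nat_const; apply: leq_sum => i _.
  have -> : ((Q - 1) * (Q - 1) = \sum_(x : L | x != 0%R) (#|L| - 1))%N.
    by rewrite sum_nat_const cardC1 QE subn1.
  apply: leq_sum => x _.
  apply: (leq_trans (@card_nonzero_solutions L (ev b0 i x) (ev b1 i x))).
  by apply/subset_leq_card/subsetP => p; rewrite !inE evE.
have swap : (\sum_(i < s) \sum_(x : L | x != 0%R)
      #|[set p : L * L | (p != 0) && (ev (word p) i x == 0)]%R| =
    \sum_(p : L * L | p != 0%R) \sum_(i < s)
      #|[set x : L | (x != 0) && (ev (word p) i x == 0)]%R|)%N.
  rewrite [RHS]exchange_big; apply: eq_bigr => i _ /=.
  (* For fixed i, both sides are sums of 1 over the incident pairs (p, x). *)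
  under eq_bigr => x _ do rewrite -sum1dep_card big_mkcondr.
  under [RHS]eq_bigr => p _ do rewrite -sum1dep_card big_mkcondr.
  exact: exchange_big.
have upper p : p != 0 -> (\sum_(i < s)
      #|[set x : L | (x != 0) && (ev (word p) i x == 0)]%R| <= #|k| - 1)%N.
  move=> p0; have := sum_dim_ker _ _ _ (word p).
  have := wC _ (wordC p) (word0 p p0).
  set d := (\sum_(i < s) _)%N => wd dE.
  have d1 : (d <= 1)%N by rewrite -dE leq_subLR leq_add2r in wd.
  rewrite (eq_bigr (fun i => \dim (lker (word p i : 'End(l))) * (#|k| - 1)))%N.
    by rewrite -big_distrl /= -[leqRHS]mul1n leq_mul2r d1 orbT.
  move=> i _; apply: (@card_nonzero_ker k l (word p i : 'End(l))).
  by apply: leq_trans d1; rewrite /d (bigD1 i) //= leq_addr.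
move: lower; rewrite swap => /leq_trans/(_ (leq_sum _ upper)).
rewrite sum_nat_const.
have -> : #|[pred p : L * L | p != 0]| = ((Q + 1) * (Q - 1))%N.
  have := cardC1 (0 : L * L); rewrite card_prod QE => ->.
  by rewrite -subn1 mulnC -subn_sqr exp1n -mulnn.
have Q1 : (0 < Q - 1)%N by rewrite subn_gt0 -QE finNzRing_gt1.
by rewrite mulnA mulnAC leq_pmul2r.
Qed.

End Counting.

(** If s >= q then q (Q - 1) <= (Q + 1) (q - 1), that is Q + 1 <= 2 q, which
    contradicts Q >= q ^ 2. *)
Lemma length_bound (q r s : nat) :
  1 < q -> 1 < r -> s * (q ^ r - 1) <= (q ^ r + 1) * (q - 1) -> s <= q - 1.
Proof.
move=> q1 r1 le_s; rewrite leqNgt; apply/negP => lt_s.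
have : q ^ 2 <= q ^ r by rewrite leq_exp2l.
rewrite expnS expn1; nia.
Qed.

Theorem mainTheorem1 (k : finFieldType) (l : fieldExtType k) (q r s : nat)
    (hq : #|k| = q) (hr : \dim {:l} = r) (hs : 0 < s)
    (C : {vspace {ffun 'I_s -> lEnd l}})
    (hdim : \dim C = 2) (hdist : has_min_distance C (r * s - 1)) :
  (r = 1 -> s <= q + 1) /\ (1 < r -> s <= q - 1).
Proof.
have q1 : 1 < q by rewrite -hq finNzRing_gt1.
case: hdist => _; rewrite -hr => /(pencil_count _ _ _ _ hdim).
rewrite hr hq => le_s; split=> [r1|r1]; last exact: length_bound le_s.
by move: le_s; rewrite r1 expn1 leq_pmul2r // subn_gt0.
Qed.
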